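(* Let $f$ be a left interval-specification on $(\Omega,\mathcal{F})$ for which there exists a constant $c>0$ satisfying the following property: for every $m\in\mathbb{Z}$ and every cylinder set $A\in\mathcal{F}_{\le m}$ there exists an integer $n<m$ such that $$f_{[n,m]}(A\mid\xi)\;\ge\;c\,f_{[n,m]}(A\mid\eta)\qquad\text{for all }\xi,\eta\in\Omega.$$ Then there exists at most one chain consistent with $f$.
   Context: Let $(E,\mathcal{E})$ be a measurable space and $\Omega\subset E^{\mathbb{Z}}$ a set of (admissible) configurations, endowed with the $\sigma$-algebra $\mathcal{F}$ which is the restriction to $\Omega$ of the product $\sigma$-algebra. For $\Lambda\subset\mathbb{Z}$, $\mathcal{F}_\Lambda\subset\mathcal{F}$ is the $\sigma$-algebra generated by the coordinates $\omega\mapsto\omega_i$, $i\in\Lambda$; $\mathcal{F}_{\le n}=\mathcal{F}_{]-\infty,n]}$. $\mathcal{S}_b$ is the set of (nonempty) finite intervals of $\mathbb{Z}$; for $\Lambda\in\mathcal{S}_b$, $l_\Lambda=\min\Lambda$, $m_\Lambda=\max\Lambda$, $\Lambda_-=\,]-\infty,l_\Lambda-1]$. A cylinder set is a set belonging to $\mathcal{F}_\Delta$ for some $\Delta\in\mathcal{S}_b$. A left interval-specification (LIS) on $(\Omega,\mathcal{F})$ is a family $f=\{f_\Lambda\}_{\Lambda\in\mathcal{S}_b}$ of probability kernels $f_\Lambda:\mathcal{F}_{\le m_\Lambda}\times\Omega\to[0,1]$ (so $f_\Lambda(\cdot\mid\omega)$ is a probability measure on $(\Omega,\mathcal{F}_{\le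 m_\Lambda})$) such that for all $\Lambda\in\mathcal{S}_b$: (a) for each $A\in\mathcal{F}_{\le m_\Lambda}$, $f_\Lambda(A\mid\cdot)$ is $\mathcal{F}_{\Lambda_-}$-measurable; (b) for each $B\in\mathcal{F}_{\Lambda_-}$ and $\omega\in\Omega$, $f_\Lambda(B\mid\omega)=\mathbf{1}_B(\omega)$; (c) for each $\Delta\in\mathcal{S}_b$ with $\Delta\supset\Lambda$, $f_\Delta f_\Lambda=f_\Delta$ on $\mathcal{F}_{\le m_\Lambda}$, i.e. $\int\!\int h(\xi)f_\Lambda(d\xi\mid\sigma)f_\Delta(d\sigma\mid\omega)=\int h(\sigma)f_\Delta(d\sigma\mid\omega)$ for each $\mathcal{F}_{\le m_\Lambda}$-measurable $h$ and each $\omega\in\Omega$. A chain consistent with $f$ is a probability measure $\mu$ on $(\Omega,\mathcal{F})$ such that $\mu f_\Lambda=\mu$ on $\mathcal{F}_{\le m_\Lambda}$ for every $\Lambda\in\mathcal{S}_b$, where $(\mu f_\Lambda)(A)=\int f_\Lambda(A\mid\omega)\mu(d\omega)$. *)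

(* Defs.v *)
From HB Require Import structures.
From mathcomp Require Import all_boot all_order all_algebra.
From mathcomp Require Import all_classical all_reals all_analysis measurable_realfun.
Set Implicit Arguments.
Unset Strict Implicit.
Unset Printing Implicit Defensive.
Import Order.TTheory GRing.Theory Num.Theory.
Local Open Scope classical_set_scope.
Local Open Scope ring_scope.

(* The set S_b of nonempty finite intervals of Z. *)
Record Sb := mkSb { lS : int ; mS : int ; leS : lS <= mS }.

Definition Sb_set (I : Sb) : set int := `[lS I, mS I]%classic.

(* The points of Omega.  A measurableType carries a default point, whence the
   nonemptiness proof as a parameter. *)
Definition config (E : Type) (Omega : set (int -> E))
  (Omega0 : Omega !=set0) : Type := set_type Omega.

Section configurations.
Context d (E : measurableType d) (Omega : set (int -> E)).
Variable Omega0 : Omega !=set0.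

HB.instance Definition _ := Choice.copy (config Omega0) (set_type Omega).

Let config_point : config Omega0 :=
  exist _ (sval (cid Omega0)) (mem_set (svalP (cid Omega0))).

HB.instance Definition _ := isPointed.Build (config Omega0) config_point.

Definition coords (w : config Omega0) : int -> E := sval w.

Definition coord_gen (L : set int) : set (set (config Omega0)) :=
  \bigcup_(i in L) preimage_set_system setT (fun w => coords w i) measurable.

(* The sigma-algebra F_L generated by the coordinates in L. *)
Definition FL (L : set int) : set (set (config Omega0)) := <<s coord_gen L >>.

(* Omega as a measurableType whose measurable sets are those of F_L. *)
Definition config_on (L : set int) : measurableType (coord_gen L).-sigma :=
  g_sigma_algebraType (coord_gen L).

Definition product_gen : set (set (int -> E)) :=
  \bigcup_(i in [set: int]) preimage_set_system setT (fun x => x i) measurable.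

(* The restriction to Omega of the product sigma-algebra on E^Z. *)
Definition Fall : set (set (config Omega0)) :=
  preimage_set_system setT coords <<s product_gen >>.

(* Omega as a measurableType whose measurable sets are those of Fall
   (see measurable_config_all). *)
Definition config_all : measurableType Fall.-sigma := g_sigma_algebraType Fall.

Lemma measurable_config_all (A : set config_all) : measurable A = Fall A.
Proof.
suff -> : (@measurable _ config_all) = Fall by [].
apply: sigma_algebra_id; apply: sigma_algebra_preimage.
exact: smallest_sigma_algebra.
Qed.

Lemma FallE (A : set (config Omega0)) : Fall A = FL setT A.
Proof.
rewrite /Fall /FL.
have -> : coord_gen setT = preimage_set_system setT coords product_gen.
  apply/seteqP; split => {}A /=.
    case=> i _ [B mB <-]; exists ((fun x : int -> E => x i) @^-1` B) => //.
    by exists i => //; exists B => //; rewrite setTI.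
  by case=> B [i _ [C mC <-]] <-; exists i => //; exists C => //; rewrite !setTI.
by rewrite g_sigma_preimageE.
Qed.

Definition is_cylinder (A : set (config Omega0)) : Prop :=
  exists D : Sb, FL (Sb_set D) A.

Variable R : realType.

Local Open Scope ereal_scope.

(* lis_kernel I w A is f_I(A | w).  The kernel type says that f_I(. | w) is a
   probability measure on (Omega, F_{<= m_I}) and, through the sigma-algebra of
   its source, that f_I(A | .) is F_{<= l_I - 1}-measurable for every A in
   F_{<= m_I}.  In lis_consistent, h ranges over the measurable functions with
   values in [0, +oo], for which both integrals are always defined. *)
Record LIS := mkLIS {
  lis_kernel :> forall I : Sb,
    R.-pker (config_on `]-oo, (lS I - 1)%R]%classic)
         ~> (config_on `]-oo, mS I]%classic) ;
  lis_proper : forall (I : Sb) (B : set (config Omega0)) (w : config Omega0),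
    FL `]-oo, (lS I - 1)%R]%classic B -> lis_kernel I w B = (\1_B w)%:E ;
  lis_consistent : forall (I J : Sb), Sb_set I `<=` Sb_set J ->
    forall h : config Omega0 -> \bar R,
    measurable_fun setT (h : config_on `]-oo, mS I]%classic -> \bar R) ->
    (forall x, 0 <= h x) ->
    forall w : config Omega0,
      \int[lis_kernel J w]_s (\int[lis_kernel I s]_x h x) =
      \int[lis_kernel J w]_s h s }.

Definition chain_consistent (f : LIS) (mu : probability config_all R) : Prop :=
  forall (I : Sb) (A : set (config Omega0)), FL `]-oo, mS I]%classic A ->
    \int[mu]_w f I w A = mu A.

End configurations.

(* Main.v *)
Require Import Defs.
From mathcomp Require Import all_boot all_order all_algebra.
From mathcomp Require Import all_classical all_reals all_analysis measurable_realfun.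
From mathcomp Require Import ring.
Import Order.TTheory GRing.Theory Num.Theory.
Local Open Scope classical_set_scope.
Local Open Scope ring_scope.
Local Open Scope ereal_scope.

(** Why at most one chain exists.  Suppose that mu and nu are consistent and
    that mu >= a nu for some a in [0, 1].  If a < 1, then (mu - a nu) / (1 - a)
    is again a probability measure and, consistency being an affine condition,
    again a chain.  On the other hand, any two chains mu' and nu' satisfy
    mu' >= c nu': for a cylinder A this is the hypothesis
    f_[n, m](A | xi) >= c f_[n, m](A | eta) integrated in eta against nu' and
    in xi against mu', and the inequality passes from cylinders to all events
    because the sets on which it holds form a monotone class.  Applied to
    (mu - a nu) / (1 - a) and nu, it gives mu >= (a + c (1 - a)) nu, that is,

        mu >= (1 - (1 - a) (1 - c)) nu.

    Starting from a = 0 and repeating k times, mu >= (1 - (1 - c)^k) nu.  As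
    0 < c <= 1, letting k tend to infinity yields mu >= nu, and exchanging the
    roles of mu and nu yields equality.

    The quotient (mu - a nu) / (1 - a) is never constructed.  All that matters
    is how it integrates f_[n, m](A | .), a function bounded below by the
    constant t = c nu(A), and [dominated_integral] expresses this in terms of
    mu and nu.  [dominated_on_generating_ring] is the monotone class argument,
    [domination_step] improves a to 1 - (1 - a) (1 - c), and [chain_le] takes
    the limit. *)

Section domination.
Context {d} {T : measurableType d} {R : realType}.
Variables mu nu : probability T R.
Implicit Types (a t : R) (G : set (set T)).

(** For finite measures, the sets that satisfy the inequality are stable under
    monotone limits but in general not under complements or proper
    differences, since a difference of two inequalities is not an inequality.
    So the pi-lambda theorem does not apply, and a ring of sets is needed to
    invoke the monotone class theorem. *)
Lemma dominated_on_generating_ring a G : (0 <= a)%R ->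
  @measurable d T = <<s G >> -> setring G -> G setT ->
  (forall A, G A -> a%:E * nu A <= mu A) ->
  forall A, measurable A -> a%:E * nu A <= mu A.
Proof.
move=> a0 mG rG GT dom.
have G_measurable A : G A -> measurable A.
  by rewrite mG; exact: sub_sigma_algebra.
pose H := [set A | measurable A /\ a%:E * nu A <= mu A].
have monoH : monotone H.
  split=> F monoF HF; split.
  - by apply: bigcup_measurable => i _; have [] := HF i.
  - have mF i : measurable (F i) by have [] := HF i.
    have mU : measurable (\bigcup_i F i) by exact: bigcup_measurable.
    have cmu := nondecreasing_cvg_mu mF mU monoF (mu := mu).
    have cnu := nondecreasing_cvg_mu mF mU monoF (mu := nu).
    apply: (lee_cvg_to (cvgeZl _ cnu) cmu) => //.
    by apply: nearW => i; have [] := HF i.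
  - by apply: bigcap_measurableType => i _; have [] := HF i.
  - have mF i : measurable (F i) by have [] := HF i.
    have mI : measurable (\bigcap_i F i) by exact: bigcap_measurableType.
    have fin (m : probability T R) : m (F 0%N) < +oo.
      by rewrite (le_lt_trans (probability_le1 _ (mF 0%N))) ?ltry.
    have cmu := nonincreasing_cvg_mu (fin mu) mF mI monoF.
    have cnu := nonincreasing_cvg_mu (fin nu) mF mI monoF.
    apply: (lee_cvg_to (cvgeZl _ cnu) cmu) => //.
    by apply: nearW => i; have [] := HF i.
have [sr0 srD srU] := smallest_sigma_ring G.
have GH : <<sr G >> `<=` H.
  apply: monotone_setring_sub_g_sigma_ring => // A GA.
  by split; [exact: G_measurable|exact: dom].
(* A sigma-ring that contains the whole space is a sigma-algebra. *)
move=> A; rewrite mG => GA; suff /GH[] : <<sr G >> A by [].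
apply: GA; split; last exact: sub_g_sigma_ring.
split=> // B srB; apply: srD => //; exact: sub_g_sigma_ring.
Qed.

(** This is the inequality t <= int g d((mu - a nu) / (1 - a)) with the
    denominator cleared.  Only the nonnegative function g - t can be compared
    under mu and a nu; the constant t contributes t to both integrals because
    both measures have mass 1. *)
Lemma dominated_integral a t (g : T -> \bar R) :
  (0 <= a)%R -> (0 <= t)%R ->
  (forall A, measurable A -> a%:E * nu A <= mu A) ->
  measurable_fun setT g -> (forall x, t%:E <= g x) ->
  a%:E * \int[nu]_x g x + ((1 - a) * t)%:E <= \int[mu]_x g x.
Proof.
move=> a0 t0 dom mg tg.
pose h x := g x - t%:E.
have h0 x : 0 <= h x by rewrite sube_ge0.
have mh : measurable_fun setT h by exact: emeasurable_funB.
have intg (m : probability T R) : \int[m]_x g x = \int[m]_x h x + t%:E.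
  rewrite -[in RHS](mule1 t%:E) -(@probability_setT _ _ _ m).
  rewrite -integral_cst// -ge0_integralD//.
  by apply: eq_integral => x _; rewrite /h subeK.
have inth : a%:E * \int[nu]_x h x <= \int[mu]_x h x.
  rewrite -[a]/(NngNum a0)%:num -ge0_integral_mscale//.
  by apply: ge0_le_measure_integral => //.
rewrite !intg muleDr//; last by rewrite ge0_adde_def ?inE ?integral_ge0.
rewrite -addeA -EFinM -EFinD -mulrDl (addrC a) subrK mul1r.
exact: leeD.
Qed.

End domination.

Section cylinders.
Context {d} {E : measurableType d} {Omega : set (int -> E)}.
Context {Omega0 : Omega !=set0}.

Lemma FL_sub (L M : set int) : L `<=` M -> @FL d E Omega Omega0 L `<=` FL M.
Proof.
move=> LM; apply: smallest_sub; first exact: smallest_sigma_algebra.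
by move=> A [i Li Ai]; apply: sub_sigma_algebra; exists i => //; exact: LM.
Qed.

Lemma FL_Fall (L : set int) : @FL d E Omega Omega0 L `<=` @Fall d E Omega Omega0.
Proof. by move=> A; rewrite FallE; exact: FL_sub. Qed.

Lemma Sb_hull (I J : Sb) :
  exists K : Sb, Sb_set I `<=` Sb_set K /\ Sb_set J `<=` Sb_set K.
Proof.
have le : (Num.min (lS I) (lS J) <= Num.max (mS I) (mS J))%R.
  by rewrite ge_min le_max leS.
exists (mkSb le); rewrite /Sb_set /=; split=> i /=;
  rewrite !in_itv/= => /andP[l m];
  by rewrite ge_min le_max l m ?orbT.
Qed.

(** Two cylinders are both determined by the coordinates in one interval, the
    hull of their bases, so the operations can be done in one sigma-algebra. *)
Lemma is_cylinder_setring : setring (@is_cylinder d E Omega Omega0).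
Proof.
have common (A B : set (config Omega0)) : is_cylinder A -> is_cylinder B ->
    exists K, FL (Sb_set K) A /\ FL (Sb_set K) B.
  move=> [I IA] [J JB]; have [K [IK JK]] := Sb_hull I J.
  by exists K; split; [exact: FL_sub IA|exact: FL_sub JB].
split.
- by exists (mkSb (lexx 0%:Z)); exact: (@measurable0 _ (config_on Omega0 _)).
- move=> A B cA cB; have [K [KA KB]] := common _ _ cA cB; exists K.
  exact: (@measurableU _ (config_on Omega0 _)).
- move=> A B cA cB; have [K [KA KB]] := common _ _ cA cB; exists K.
  exact: (@measurableD _ (config_on Omega0 _)).
Qed.

Lemma is_cylinder_setT : @is_cylinder d E Omega Omega0 setT.
Proof.
by exists (mkSb (lexx 0%:Z)); exact: (@measurableT _ (config_on Omega0 _)).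
Qed.

Lemma measurable_cylinders :
  @measurable _ (config_all Omega0) = <<s @is_cylinder d E Omega Omega0 >>.
Proof.
apply/seteqP; split=> A.
  rewrite measurable_config_all FallE; move: A; apply: smallest_sub.
    exact: smallest_sigma_algebra.
  move=> A [i _ Ai]; apply: sub_sigma_algebra.
  exists (mkSb (lexx i)); apply: sub_sigma_algebra; exists i => //.
  by rewrite /Sb_set /= in_itv/= lexx.
apply: smallest_sub; first exact: sigma_algebra_measurable.
by move=> {}A [I IA]; rewrite measurable_config_all; exact: FL_Fall IA.
Qed.

(** The kernel is measurable with respect to the past of I, whereas chains
    integrate it on the whole sigma-algebra. *)
Lemma measurable_kernel_all {R : realType} (f : LIS Omega0 R) (I : Sb) A :
  FL `]-oo, mS I] A ->
  measurable_fun setT (fun w : config_all Omega0 => f I w A).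
Proof.
move=> mA _ Y mY; rewrite measurable_config_all.
by apply: FL_Fall; exact: (measurable_kernel (f I) A mA measurableT Y mY).
Qed.

End cylinders.

Section iteration.
Context {d} {E : measurableType d} {Omega : set (int -> E)}.
Context {Omega0 : Omega !=set0} {R : realType}.
Variables (f : LIS Omega0 R) (c : R).
Hypothesis c0 : (0 < c)%R.
Hypothesis boundary : forall (m : int) (A : set (config Omega0)),
  is_cylinder A -> FL `]-oo, m]%classic A ->
  exists (n : int) (lt_nm : (n < m)%R), forall xi eta : config Omega0,
    c%:E * f (mkSb (ltW lt_nm)) eta A <= f (mkSb (ltW lt_nm)) xi A.

(** The whole space is a cylinder, to which every kernel gives mass 1. *)
Lemma boundary_le1 : (c <= 1)%R.
Proof.
have mT : @FL _ _ _ Omega0 `]-oo, 0%:Z]%classic setT.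
  exact: (@measurableT _ (config_on Omega0 _)).
have [n [lt_n0 fT]] := boundary 0%:Z _ is_cylinder_setT mT.
by have := fT point point; rewrite !prob_kernel mule1 lee_fin.
Qed.

Variables mu nu : probability (config_all Omega0) R.
Hypotheses (f_mu : chain_consistent f mu) (f_nu : chain_consistent f nu).

(** With g = f_[n, m](A | .), integrating the hypothesis against nu gives
    g >= c nu(A), while consistency says that g has integrals mu(A) and nu(A);
    hence mu(A) >= a nu(A) + (1 - a) c nu(A). *)
Lemma domination_step (a : R) : (0 <= a <= 1)%R ->
  (forall A, measurable A -> a%:E * nu A <= mu A) ->
  forall A, measurable A -> (1 - (1 - a) * (1 - c))%:E * nu A <= mu A.
Proof.
move=> /andP[a0 a1] dom; have c1 := boundary_le1.
apply: (dominated_on_generating_ring mu nu _ (@is_cylinder d E Omega Omega0)).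
- by rewrite subr_ge0 mulr_ile1 ?subr_ge0 ?gerBl ?(ltW c0).
- exact: measurable_cylinders.
- exact: is_cylinder_setring.
- exact: is_cylinder_setT.
move=> A cA; have [D DA] := cA.
(* The base D of the cylinder gives the time m at which the hypothesis is
   used: m is the right end of D. *)
have D_past : Sb_set D `<=` `]-oo, mS D]%classic.
  by rewrite /Sb_set => i; rewrite /= !in_itv /= => /andP[].
have mA : FL `]-oo, mS D]%classic A := FL_sub _ _ D_past A DA.
have [n [lt_nm fA]] := boundary _ _ cA mA.
set I := mkSb (ltW lt_nm) in fA.
have mfA := measurable_kernel_all f I _ mA.
have nuA : nu A = (fine (nu A))%:E.
  by rewrite fineK// fin_num_measure// measurable_config_all; exact: FL_Fall mA.
have lower w : (c * fine (nu A))%:E <= f I w A.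
  rewrite EFinM -nuA -(f_nu I _ mA) -ge0_integralZl//; last by rewrite lee_fin ltW.
  (* f I w A is a constant for the integration in eta. *)
  rewrite -[leRHS]mule1 -(@probability_setT _ _ _ nu) -integral_cst//.
  apply: ge0_le_integral => //; last by move=> eta _; exact: fA.
  - by move=> x _; rewrite mule_ge0// lee_fin ltW.
  - exact: measurable_funeM.
have t0 : (0 <= c * fine (nu A))%R by rewrite mulr_ge0 ?fine_ge0// ltW.
have := dominated_integral mu nu a _ _ a0 t0 dom mfA lower.
rewrite (f_mu I _ mA) (f_nu I _ mA); apply: le_trans.
rewrite nuA /= -!EFinM -EFinD lee_fin.
by rewrite le_eqVlt; apply/orP; left; apply/eqP; ring.
Qed.

Lemma chain_le A : measurable A -> nu A <= mu A.
Proof.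
move=> mA; have c1 := boundary_le1.
have q0 : (0 <= 1 - c)%R by rewrite subr_ge0.
have q1 : (1 - c < 1)%R by rewrite gtrBl.
have dom k : forall B, measurable B -> (1 - (1 - c) ^+ k)%:E * nu B <= mu B.
  elim: k => [B mB|k IH]; first by rewrite expr0 subrr mul0e.
  (* The step, taken at a = 1 - (1 - c) ^+ k. *)
  rewrite exprSr -[X in (X * _)%R](subKr 1%R); apply: domination_step => //.
  by rewrite subr_ge0 exprn_ile1 ?(ltW q1)//= gerBl exprn_ge0.
have fnu : nu A \is a fin_num by rewrite fin_num_measure.
suff cv : (fun k => (1 - (1 - c) ^+ k)%:E * nu A) @ \oo --> nu A.
  apply: (lee_cvg_to cv (cvg_cst _)).
  by apply: nearW => k; exact: dom.
rewrite -[X in _ --> X]mul1e; apply: cvgeZr => //.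
apply: cvg_EFin; first exact: nearW.
rewrite -[X in _ --> X](subr0 1%R); apply: cvgB; first exact: cvg_cst.
by apply: cvg_expr; rewrite ger0_norm.
Qed.

End iteration.

Theorem theorem4p1 (d : measure_display) (E : measurableType d)
    (Omega : set (int -> E)) (Omega0 : Omega !=set0) (R : realType)
    (f : LIS Omega0 R) :
  (exists c : R, (0 < c)%R /\
     forall (m : int) (A : set (config Omega0)),
       is_cylinder A -> FL `]-oo, m]%classic A ->
       exists (n : int) (lt_nm : (n < m)%R),
         forall xi eta : config Omega0,
           c%:E * f (mkSb (ltW lt_nm)) eta A <= f (mkSb (ltW lt_nm)) xi A) ->
  forall mu nu : probability (config_all Omega0) R,
    chain_consistent f mu -> chain_consistent f nu ->
    forall A : set (config Omega0), Fall A -> mu A = nu A.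
Proof.
move=> [c [c0 boundary]] mu nu f_mu f_nu A; rewrite -measurable_config_all => mA.
apply/eqP; rewrite eq_le; apply/andP; split; exact: (chain_le f c).
Qed.
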